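(* Let $n,q\in\mathbb{N}$ and $m\in\mathbb{N}_{0}$. Let $\chi$ be a Dirichlet character modulo $q$. Then, for every $\lambda\in\mathbb{C}\setminus\{0\}$, $$\sum_{k=1}^{nq}\chi(k)\lambda^{-k}k^{m}=\frac{\lambda^{-qn}}{m+1}\sum_{k=0}^{m}\binom{m+1}{k}(-1)^{k}\beta_{k,\chi^{-}}(\{0\}_{\chi},\lambda)(nq)^{m+1-k}+\frac{(-1)^{m+1}\beta_{m+1,\chi^{-}}(\{0\}_{\chi},\lambda)(\lambda^{-nq}-1)}{m+1}.$$
   Context: $\mathbb{N}$ is the set of positive integers and $\mathbb{N}_0$ the set of non-negative integers. For $x\in\mathbb{R}$, $[x]$ is the integer part (floor) and $\{x\}=x-[x]\in[0,1)$ the fractional part. A Dirichlet character modulo $q$ is extended to $\mathbb{Z}$ in the usual way (zero on integers not coprime to $q$); for $q=1$ it is identically $1$, in particular $\chi(0)=1$. The Apostol-Bernoulli polynomials $\beta_j(x,\mu)$, for $\mu\in\mathbb{C}\setminus\{0\}$ and $j\in\mathbb{N}_0$, are defined by the Taylor expansion at $t=0$ $$\frac{te^{xt}}{\mu e^{t}-1}=\sum_{j=0}^{\infty}\beta_{j}(x,\mu)\frac{t^{j}}{j!}$$ (with the removable singularity at $t=0$ filled in when $\mu=1$). For $j\in\mathbb{N}_0$, $x\in\mathbb{R}$ and $\lambda\in\mathbb{C}\setminus\{0\}$, the single piece of notation $\beta_{j,\chi^{-}}(\{x\}_{\chi},\lambda)$ stands for $$\beta_{j,\chi^{-}}(\{x\}_{\chi},\lambda)=q^{j-1}\sum_{r=1}^{q}\chi(-r)\lambda^{r-q\left[\frac{x+r}{q}\right]}\beta_{j}\Bigl(\Bigl\{\frac{x+r}{q}\Bigr\},\lambda^{q}\Bigr).$$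 *)

(* Defs.v *)
From HB Require Import structures.
From mathcomp Require Import all_boot all_order all_algebra.
From mathcomp Require Import complex.
From mathcomp Require Import all_classical all_reals all_analysis.

Set Implicit Arguments.
Unset Strict Implicit.
Unset Printing Implicit Defensive.

Import Order.TTheory GRing.Theory Num.Theory.
Import numFieldNormedType.Exports.

Local Open Scope classical_set_scope.
Local Open Scope complex_scope.
Local Open Scope ring_scope.

(* R[i] bundled as a numClosedFieldType: this alias is what lets the topology
   that numFieldNormedType puts on any numFieldType (the one given by the
   modulus) be inferred, which does not happen for the bare R[i]. *)
Definition Cplx (R : realType) : numClosedFieldType := R[i].

Definition cexp (R : realType) (z : Cplx R) : Cplx R :=
  (expR (complex.Re z))%:C * (cos (complex.Im z) +i* sin (complex.Im z)).

Definition frac_part (R : realType) (x : R) : R := x - (Num.floor x)%:~R.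

(* A Dirichlet character modulo q, already extended to the integers.  For
   q = 1 the three conditions force chi to be identically 1, so chi 0 = 1. *)
Definition dirichlet_character (R : realType) (q : nat) (chi : int -> Cplx R)
    : Prop :=
  [/\ forall a b : int, (a = b %[mod q%:Z])%Z -> chi a = chi b,
      forall a b : int, chi (a * b) = chi a * chi b
    & forall a : int, (chi a != 0) = coprimez a q%:Z].

(* Only the values at small t != 0 matter below; there the denominator does not
   vanish. *)
Definition apostol_bernoulli_gen (R : realType) (x mu t : Cplx R) : Cplx R :=
  t * cexp (x * t) / (mu * cexp t - 1).

(* The neighbourhood of 0 is punctured because for mu = 1 the singularity at
   t = 0 is removable: the expansion is that of the extension by continuity,
   and it determines b. *)
Definition taylor_at0 (R : realType) (f : Cplx R -> Cplx R)
    (b : nat -> Cplx R) : Prop :=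
  \forall t \near (0 : Cplx R)^',
    series (fun j : nat => b j * (t ^+ j / j`!%:R)) @ \oo --> f t.

(* get selects the unique sequence of coefficients; one exists whenever
   mu != 0. *)
Definition apostol_bernoulli (R : realType) (j : nat) (x mu : Cplx R)
    : Cplx R :=
  get [set b : nat -> Cplx R | taylor_at0 (apostol_bernoulli_gen x mu) b] j.

(* This is beta_{j,chi^-}({x}_chi, lambda); the exponent j - 1 is an integer,
   so that j = 0 contributes the factor 1 / q. *)
Definition apostol_bernoulli_chi (R : realType) (q : nat)
    (chi : int -> Cplx R) (j : nat) (x : R) (lambda : Cplx R) : Cplx R :=
  q%:R ^ (j%:Z - 1) *
  \sum_(1 <= r < q.+1)
     chi (- r%:Z) *
     lambda ^ (r%:Z - q%:Z * Num.floor ((x + r%:R) / q%:R)) *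
     apostol_bernoulli j (frac_part ((x + r%:R) / q%:R))%:C (lambda ^+ q).

(* Main.v *)
Require Import Defs.
From HB Require Import structures.
From mathcomp Require Import all_boot all_order all_algebra.
From mathcomp Require Import complex ring.
From mathcomp Require Import all_classical all_reals all_analysis.

Set Implicit Arguments.
Unset Strict Implicit.
Unset Printing Implicit Defensive.

Import Order.TTheory GRing.Theory Num.Theory.
Import numFieldNormedType.Exports.

Local Open Scope classical_set_scope.
Local Open Scope complex_scope.
Local Open Scope ring_scope.

(** Generating functions turn the identity into one between two functions of
t near 0.  Let N = n * q and

  F(t) = sum_(r < q) chi(-r) lambda^r t e^(r t) / (lambda^q e^(q t) - 1).

Rescaling the variable of each Apostol-Bernoulli generating function by q
shows that the k-th Taylor coefficient of F is beta_k / k!, where beta_k is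
the character analogue at x = 0 (apostol_bernoulli_chi0 and
character_bernoulli_has_ps).  On the other side, put w = lambda e^(-t) and
split the sum over 1 <= k <= N into n blocks of length q.  As chi has period
q, block number j, read backwards, is w^(-jq) sum_(r < q) chi(-r) w^r, so the
blocks form a geometric progression (sum_periodic) and

  t sum_(1 <= k <= N) chi(k) lambda^(-k) e^(k t)
    = F(-t) (lambda^(-N) e^(N t) - 1)

for small nonzero t (exp_sum_character).  Comparing the coefficients of
t^(m+1) gives the theorem.  The term k = m + 1 of the product on the right is
the only one that meets the summand -1 of the second factor, which is why it
stands apart.

The numbers beta_j(x, mu) are picked out by choice among the sequences whose
Taylor series converges to the generating function, so the comparison needs
such a sequence to exist.  The relation has_ps f a says that f is the sum of
the power series with coefficients a near 0, with 0 itself excluded, and that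
a grows at most geometrically.  It is stable under sums, products (has_psM),
quotients (has_psV), division by t (has_ps_shift) and rescaling, it holds for
the exponential (has_ps_cexp), and it determines a (has_ps_uniq).  Hence the
generating function has an expansion, after one division by t in the case
mu = 1, where the denominator vanishes at 0.  Conversely, a Taylor series
that converges at one nonzero point has geometrically bounded coefficients
(taylor_at0_has_ps), so the chosen sequence obeys the same calculus. *)

(** * Cauchy products of numerical series *)

Definition cauchy_prod (K : pzRingType) (u v : nat -> K) (n : nat) : K :=
  \sum_(i < n.+1) u i * v (n - i)%N.

Lemma series_cauchy_prod (K : numDomainType) (u v : nat -> K) (N : nat) :
  series (cauchy_prod u v) N = \sum_(i < N) u i * series v (N - i)%N.
Proof.
elim: N => [|N IH]; first by rewrite /series /= big_geq // big_ord0.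
rewrite /series /= big_nat_recr //= -[X in X + _]/(series (cauchy_prod u v) N) IH.
rewrite /cauchy_prod !big_ord_recr /= subnn subSnn addrA -big_split /=.
congr (_ + _); last by rewrite big_nat1.
apply: eq_bigr => i _.
by rewrite subSn ?(ltnW (ltn_ord i)) // big_nat_recr //= mulrDr.
Qed.

Section Cauchy.
Context {K : numFieldType}.
Implicit Types u v : nat -> K.

(** Each tail of the majorant is 4/3 of its first term; the sharper constant is
not worth its denominators. *)
Lemma series_tail_le v (M : K) (hv : forall n, `|v n| <= M * 4^-1 ^+ n) k N :
  (k <= N)%N -> `|series v N - series v k| <= 2 * M * 4^-1 ^+ k.
Proof.
move=> kN.
have M0 : 0 <= M by have := le_trans (normr_ge0 _) (hv 0); rewrite expr0 mulr1.
(* Keeping the subtracted term makes the bound telescope. *)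
suff H d : `|series v (k + d)%N - series v k|
    <= 2 * M * (4^-1 ^+ k - 4^-1 ^+ (k + d)).
  rewrite -(subnKC kN) (le_trans (H _)) // ler_wpM2l ?mulr_ge0 //.
  by rewrite gerBl exprn_ge0 ?invr_ge0.
elim: d => [|d IH]; first by rewrite addn0 !subrr normr0 mulr0.
rewrite addnS /series /= big_nat_recr //= addrAC.
apply: le_trans (ler_normD _ _) _.
apply: le_trans (lerD IH (hv _)) _.
rewrite -subr_ge0 exprS.
set z := 4^-1 ^+ (k + d).
rewrite (_ : _ - _ = M * z / 2).
  by rewrite divr_ge0 // mulr_ge0 // exprn_ge0 // invr_ge0.
by field.
Qed.

(** By series_cauchy_prod the difference is the sum over i < N of u i times the
tail of v from N - i to N.  Each such product is at most 2 M^2 4^-N, and the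
factor N is absorbed by replacing 4^-N with 2^-N. *)
Lemma cauchy_defect_le u v (M : K) (hu : forall n, `|u n| <= M * 4^-1 ^+ n)
  (hv : forall n, `|v n| <= M * 4^-1 ^+ n) N :
  `|series u N * series v N - series (cauchy_prod u v) N| <= 2 * M ^+ 2 * 2^-1 ^+ N.
Proof.
have M0 : 0 <= M by have := le_trans (normr_ge0 _) (hv 0); rewrite expr0 mulr1.
rewrite series_cauchy_prod {1}/series /= big_mkord mulr_suml -sumrB.
apply: le_trans (ler_norm_sum _ _ _) _.
apply: (@le_trans _ _ (\sum_(i < N) 2 * M ^+ 2 * 4^-1 ^+ N)).
  apply: ler_sum => i _; rewrite -mulrBr normrM.
  apply: le_trans (ler_pM _ _ (hu i) (series_tail_le hv (leq_subr i N))) _ => //.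
  rewrite -[in leRHS](subnKC (ltnW (ltn_ord i))) exprD le_eqVlt; apply/orP; left.
  by apply/eqP; ring.
rewrite sumr_const card_ord -[_ *+ N]mulr_natr -mulrA.
apply: ler_wpM2l; first by rewrite mulr_ge0 ?exprn_ge0.
have -> : 4^-1 = 2^-1 * 2^-1 :> K by field.
rewrite exprMn -mulrA ler_piMr ?exprn_ge0 ?invr_ge0 //.
rewrite exprVn mulrC ler_pdivrMr ?exprn_gt0 // mul1r -natrX ler_nat.
exact: ltnW (ltn_expl _ _).
Qed.

End Cauchy.

Section Complex.
Context {R : realType}.
Local Notation C := (Cplx R).

(** The order on the complex numbers is partial and not archimedean as a
structure, so limits of real sequences are transported from the real field. *)
Lemma cvg_to_complex (u : nat -> R) (l : R) :
  u @ \oo --> l -> (fun n => (u n)%:C : C) @ \oo --> (l%:C : C).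
Proof.
move=> /cvgrPdist_lt ul; apply/cvgrPdist_lt => e e0.
have [eI eR] : complex.Im e = 0 /\ 0 < complex.Re e.
  by move: e0; rewrite ltcE /= => /andP[/eqP].
have := ul _ eR; apply: filterS => n H.
by rewrite -rmorphB /= normc_def /= expr0n /= addr0 sqrtr_sqr ltcE /= eI eqxx.
Qed.

(** For the reciprocal of a power series, the convergence of the second factor is
deduced from this limit, hence the form as a difference of partial sums. *)
Lemma cvg_cauchy_defect (u v : nat -> C) (M : C)
  (hu : forall n, `|u n| <= M * 4^-1 ^+ n)
  (hv : forall n, `|v n| <= M * 4^-1 ^+ n) :
  (fun N => series u N * series v N - series (cauchy_prod u v) N) @ \oo --> (0 : C).
Proof.
apply: norm_cvg0.
have half0 : (fun N => 2^-1 ^+ N : C) @ \oo --> (0 : C).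
  have -> : (fun N => 2^-1 ^+ N : C) = (fun N => ((2^-1 ^+ N : R)%:C : C)).
    by apply/funext => N; rewrite rmorphXn /= fmorphV rmorph_nat.
  apply: cvg_to_complex; apply: cvg_expr.
  by rewrite ger0_norm ?invr_ge0 // invf_lt1 ?ltr1n.
have h0 : (fun N => (2 * M ^+ 2) * 2^-1 ^+ N : C) @ \oo --> (0 : C).
  rewrite -[X in _ --> X](mulr0 (2 * M ^+ 2)).
  exact: (@cvgM C _ _ _ _ _ _ _ (cvg_cst _) half0).
apply/(@cvgr0Pnorm_lt C C) => e e0.
move/(@cvgr0Pnorm_lt C C) : h0 => /(_ _ e0).
apply: filterS => N; apply: le_lt_trans; rewrite normr_id.
rewrite [leRHS]ger0_norm; first exact: cauchy_defect_le.
by have := le_trans (normr_ge0 _) (cauchy_defect_le hu hv N).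
Qed.

End Complex.

(** * Power series expansions near a punctured point *)

Lemma cauchy_prodX (K : comPzRingType) (a b : nat -> K) (t : K) (n : nat) :
  cauchy_prod (fun n => a n * t ^+ n) (fun n => b n * t ^+ n) n =
  cauchy_prod a b n * t ^+ n.
Proof.
rewrite /cauchy_prod mulr_suml; apply: eq_bigr => i _.
have -> : t ^+ n = t ^+ i * t ^+ (n - i) by rewrite -exprD subnKC // -ltnS.
by rewrite mulrACA.
Qed.

Section PowerSeries.
Context {R : realType}.
Local Notation C := (Cplx R).
Implicit Types (f g : C -> C) (a b : nat -> C).

(** One constant K >= 1 serves both as the factor and as the ratio, which keeps
the stability proofs short. *)
Definition geometric_bound a : Prop :=
  exists2 K : C, 1 <= K & forall n, `|a n| <= K ^+ n.+1.

(** The point t = 0 is excluded, so that f t / t is allowed without a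
convention for its value at 0. *)
Definition has_ps f a : Prop :=
  geometric_bound a /\
  \forall t \near (0 : C)^', series (fun n => a n * t ^+ n) @ \oo --> f t.

Lemma eq_cvg_seq (u v : nat -> C) (l : C) :
  u =1 v -> u @ \oo --> l -> v @ \oo --> l.
Proof. by move=> /funext ->. Qed.

(** It suffices to take t in the disc of radius 1 / (4 K). *)
Lemma geometric_bound_terms a : geometric_bound a ->
  exists2 M : C, 0 <= M & \forall t \near (0 : C)^',
    forall n, `|a n * t ^+ n| <= M * 4^-1 ^+ n.
Proof.
move=> [K K1 aK]; have K0 : 0 < K := lt_le_trans ltr01 K1.
exists K; first exact: ltW.
have e0 : 0 < (4 * K)^-1 by rewrite invr_gt0 mulr_gt0.
have := @dnbhs0_le C C _ e0; apply: filterS => t ht n.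
rewrite normrM normrX.
apply: (@le_trans _ _ (K ^+ n.+1 * (4 * K)^-1 ^+ n)).
  apply: ler_pM => //.
  by rewrite lerXn2r ?nnegrE ?normr_ge0 ?(ltW e0).
rewrite le_eqVlt; apply/orP; left; apply/eqP.
rewrite invfM exprMn exprS.
have KK : K ^+ n * K^-1 ^+ n = 1 by rewrite -exprMn divff ?expr1n // gt_eqF.
by rewrite -[RHS]mulr1 -KK; ring.
Qed.

(** The common constant is what the Cauchy product estimates take as input. *)
Lemma geometric_bound_terms2 a b :
  geometric_bound a -> geometric_bound b ->
  exists M : C, \forall t \near (0 : C)^',
    (forall n, `|a n * t ^+ n| <= M * 4^-1 ^+ n) /\
    (forall n, `|b n * t ^+ n| <= M * 4^-1 ^+ n).
Proof.
move=> /geometric_bound_terms [M M0 Ma] /geometric_bound_terms [N N0 Nb].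
exists (M + N); apply: filterS2 Ma Nb => t hM hN; split=> n.
  apply: (le_trans (hM n)).
  by rewrite ler_wpM2r ?exprn_ge0 ?invr_ge0 // lerDl.
apply: (le_trans (hN n)).
by rewrite ler_wpM2r ?exprn_ge0 ?invr_ge0 // lerDr.
Qed.

(** All n + 1 terms are at most G^(n+2) with G = K + L, and n + 1 <= 2^(n+2);
so (2 G)^(n+2) <= ((2 G)^2)^(n+1). *)
Lemma geometric_bound_cauchy_prod a b :
  geometric_bound a -> geometric_bound b -> geometric_bound (cauchy_prod a b).
Proof.
move=> [K K1 aK] [L L1 bL]; pose G := K + L.
have K0 : 0 <= K := le_trans ler01 K1.
have L0 : 0 <= L := le_trans ler01 L1.
have KG : K <= G by rewrite lerDl.
have LG : L <= G by rewrite lerDr.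
have G0 : 0 <= G := le_trans K0 KG.
have G1 : 1 <= 2 * G.
  by rewrite (le_trans K1) // (le_trans KG) // mulr_natl mulr2n lerDl.
exists ((2 * G) ^+ 2); first exact: exprn_ege1.
move=> n; apply: le_trans (ler_norm_sum _ _ _) _.
apply: (@le_trans _ _ (\sum_(i < n.+1) G ^+ n.+2)).
  apply: ler_sum => i _; rewrite normrM.
  have -> : n.+2 = (i.+1 + (n - i).+1)%N by rewrite addSn addnS subnKC // -ltnS.
  rewrite exprD; apply: ler_pM => //.
    by apply: le_trans (aK i) _; rewrite lerXn2r ?nnegrE.
  by apply: le_trans (bL _) _; rewrite lerXn2r ?nnegrE.
rewrite sumr_const card_ord -[_ *+ _]mulr_natl.
apply: (@le_trans _ _ ((2 * G) ^+ n.+2)).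
  rewrite exprMn ler_wpM2r ?exprn_ge0 // -natrX ler_nat.
  by rewrite (leq_trans (ltnW (ltn_expl n.+1 (ltnSn 1)))) // leq_exp2l.
by rewrite -exprM ler_weXn2l // mul2n -addnn addSn addnS ltnS ltnS leq_addr.
Qed.

Lemma has_psM f g a b : has_ps f a -> has_ps g b ->
  has_ps (fun t => f t * g t) (cauchy_prod a b).
Proof.
move=> [ga fa] [gb fb]; split; first exact: geometric_bound_cauchy_prod.
have [M Mab] := geometric_bound_terms2 ga gb.
apply: filterS2 (filterI fa fb) Mab => t [ha hb] [hM hN].
have hd := cvg_cauchy_defect hM hN.
rewrite -(funext (cauchy_prodX a b t)).
rewrite -[X in _ --> X]subr0.
apply: eq_cvg_seq (cvgB (@cvgM C _ _ _ _ _ _ _ ha hb) hd) => k.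
by rewrite !fctE opprB addrC subrK.
Qed.

Lemma has_ps_ext f g a : (\forall t \near (0 : C)^', f t = g t) ->
  has_ps f a -> has_ps g a.
Proof.
move=> fg [ga fa]; split; first exact: ga.
by move: fg fa; apply: filterS2 => t -> ha; exact: ha.
Qed.

Lemma has_ps_eq f g a b : f =1 g -> a =1 b -> has_ps f a -> has_ps g b.
Proof. by move=> /funext -> /funext ->. Qed.

Lemma has_psD f g a b : has_ps f a -> has_ps g b ->
  has_ps (fun t => f t + g t) (fun n => a n + b n).
Proof.
move=> [[K K1 aK] fa] [[L L1 bL] gb]; split.
  have K0 : 0 <= K := le_trans ler01 K1.
  have L0 : 0 <= L := le_trans ler01 L1.
  exists (K + L); first by rewrite (le_trans K1) // lerDl.
  move=> n; apply: le_trans (ler_normD _ _) _.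
  apply: le_trans (lerD (aK n) (bL n)) _.
  rewrite !exprS mulrDl lerD //.
    by rewrite ler_wpM2l // lerXn2r ?nnegrE ?addr_ge0 // lerDl.
  by rewrite ler_wpM2l // lerXn2r ?nnegrE ?addr_ge0 // lerDr.
move: fa gb; apply: filterS2 => t ha hb.
apply: eq_cvg_seq (cvgD ha hb) => N.
by rewrite fctE /series /= -big_split /=; apply: eq_bigr => i _; rewrite mulrDl.
Qed.

Lemma has_ps_cst (c : C) : has_ps (fun=> c) (fun n => c *+ (n == 0%N)).
Proof.
split.
  exists (1 + `|c|); first by rewrite lerDl.
  case=> [|n] /=; first by rewrite expr1 lerDr.
  by rewrite normr0 exprn_ge0 // addr_ge0.
apply: filterE => t; rewrite -(@cvg_shiftS C).
apply: (@eq_cvg_seq (fun=> c)) => [N|]; last exact: cvg_cst.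
rewrite /series /= big_nat_recl //= expr0 mulr1 big1 ?addr0 //.
by move=> i _; rewrite mul0r.
Qed.

Lemma cauchy_prod_cst (K : pzRingType) (c : K) (a : nat -> K) n :
  cauchy_prod (fun n => c *+ (n == 0%N)) a n = c * a n.
Proof.
rewrite /cauchy_prod big_ord_recl /= subn0 big1 ?addr0 // => i _.
by rewrite mul0r.
Qed.

Lemma has_psZ (c : C) f a : has_ps f a ->
  has_ps (fun t => c * f t) (fun n => c * a n).
Proof.
move=> fa; apply: has_ps_eq (has_psM (has_ps_cst c) fa) => [t|n]; first by [].
by rewrite cauchy_prod_cst.
Qed.

Lemma has_ps_sum (I : Type) (r : seq I) (F : I -> C -> C) (A : I -> nat -> C) :
  (forall i, has_ps (F i) (A i)) ->
  has_ps (fun t => \sum_(i <- r) F i t) (fun n => \sum_(i <- r) A i n).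
Proof.
move=> FA; elim: r => [|i r IH].
  by apply: has_ps_eq (has_ps_cst 0) => t; rewrite big_nil ?mul0rn.
by apply: has_ps_eq (has_psD (FA i) IH) => t; rewrite big_cons.
Qed.

Lemma has_ps_bounded f a : has_ps f a ->
  exists2 M : C, 0 < M & \forall t \near (0 : C)^', `|f t| <= M.
Proof.
move=> [ga fa]; have [M M0 Ma] := geometric_bound_terms ga.
exists (2 * M + 1); first by rewrite ltr_wpDl // mulr_ge0.
move: fa Ma; apply: filterS2 => t ha hM.
have /(_ _ 1 ltr01) [N _ /(_ N (leqnn N)) /= hN] :=
  (@cvgrPdist_lt C C _ _ _ _ _).1 ha.
rewrite -[f t](subrK (series (fun n => a n * t ^+ n) N)) addrC.
apply: le_trans (ler_normD _ _) _; apply: lerD; last exact: ltW.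
have := series_tail_le hM (leq0n N); rewrite expr0 mulr1.
by rewrite {2}/series /= big_geq // subr0.
Qed.

(** Division by t turns every question about coefficients into one about the
constant term. *)
Lemma has_ps_shift f a : has_ps f a ->
  has_ps (fun t => (f t - a 0%N) / t) (fun n => a n.+1).
Proof.
move=> [[K K1 aK] fa]; split.
  exists (K ^+ 2); first exact: exprn_ege1.
  move=> n; apply: le_trans (aK _) _; rewrite -exprM ler_weXn2l //.
  by rewrite mul2n -addnn addSn addnS ltnS ltnS leq_addr.
have hn : \forall t \near (0 : C)^', t != 0 by exact: nbhs_dnbhs_neq.
move: fa hn; apply: filterS2 => t ha t0.
have -> : series (fun n => a n.+1 * t ^+ n) =
    fun N => (series (fun n => a n * t ^+ n) N.+1 - a 0%N) / t.
  apply/funext => N; rewrite {2}/series /= big_nat_recl //= expr0 mulr1.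
  rewrite addrC addKr mulr_suml /series /=; apply: eq_bigr => i _.
  by rewrite exprSr mulrA mulfK.
have h1 : (fun N => series (fun n => a n * t ^+ n) N.+1) @ \oo --> f t.
  by rewrite (@cvg_shiftS C).
exact: (@cvgM C _ _ _ _ _ _ _ (cvgB h1 (cvg_cst _)) (cvg_cst _)).
Qed.

Lemma has_ps_near0 f a : has_ps f a ->
  exists2 M : C, 0 < M & \forall t \near (0 : C)^', `|f t - a 0%N| <= M * `|t|.
Proof.
move=> /has_ps_shift /has_ps_bounded [M M0 fM]; exists M => //.
have hn : \forall t \near (0 : C)^', t != 0 by exact: nbhs_dnbhs_neq.
apply: filterS2 fM hn => t ht t0.
by rewrite -[f t - _](divfK t0) normrM ler_wpM2r.
Qed.

(** By has_ps_near0 the values stay within M |t| of the constant term. *)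
Lemma has_ps_neq0 f a : has_ps f a -> a 0%N != 0 ->
  \forall t \near (0 : C)^', f t != 0.
Proof.
move=> /has_ps_near0 [M M0 fM] a0.
have e0 : 0 < `|a 0%N| / M by rewrite divr_gt0 // normr_gt0.
apply: filterS2 fM (@dnbhs0_lt C C _ e0) => t ht.
rewrite ltr_pdivlMr // mulrC => tM; apply/eqP => ft0.
have := le_lt_trans ht tM.
by rewrite ft0 sub0r normrN ltxx.
Qed.

(** A nonzero constant term would force nonvanishing near 0; the other
coefficients become constant terms after repeated division by t. *)
Lemma has_ps0 a : has_ps (fun=> 0) a -> a =1 fun=> 0.
Proof.
have const0 b : has_ps (fun=> 0) b -> b 0%N = 0.
  move=> hb; apply/eqP/negPn/negP => b0.
  by have [t /eqP] := @filter_ex _ _ (Proper_dnbhs_numFieldType _) _ (has_ps_neq0 hb b0).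
move=> h n; elim: n a h => [|n IH] a ha; first exact: const0.
apply: (IH (fun n => a n.+1)); apply: has_ps_eq (has_ps_shift ha) => t //=.
by rewrite (const0 _ ha) subr0 mul0r.
Qed.

End PowerSeries.

(** * Reciprocals of power series *)

Section Inverse.

(** When a 0 is invertible, the fixed points c of this map are the solutions of
a * c = 1 for the Cauchy product: it solves the n-th equation for c n in terms of the earlier entries. *)
Definition inv_coef_step (K : unitRingType) (a c : nat -> K) (n : nat) : K :=
  (a 0%N)^-1 * ((n == 0%N)%:R - \sum_(i < n) a i.+1 * c (n - i.+1)%N).

(** Entry n of an iterate no longer changes after n + 1 steps, whatever the
starting sequence. *)
Definition inv_coef (K : unitRingType) (a : nat -> K) (n : nat) : K :=
  iter n.+1 (inv_coef_step a) (fun=> 0) n.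

Lemma inv_coefE (K : unitRingType) (a : nat -> K) n :
  inv_coef a n = inv_coef_step a (inv_coef a) n.
Proof.
have stable N N' m : (m < N)%N -> (m < N')%N ->
    iter N (inv_coef_step a) (fun=> 0) m = iter N' (inv_coef_step a) (fun=> 0) m.
  elim/ltn_ind: m N N' => m IH [//|N] [//|N']; rewrite !ltnS => mN mN' /=.
  congr (_ * (_ - _)); apply: eq_bigr => i _; congr (_ * _).
  have im : (m - i.+1 < m)%N by rewrite ltn_subrL /= (leq_ltn_trans _ (ltn_ord i)).
  by apply: IH => //; exact: leq_trans im _.
rewrite {1}/inv_coef /=; congr (_ * (_ - _)); apply: eq_bigr => i _.
congr (_ * _); apply: stable => //.
by rewrite ltn_subrL /= (leq_ltn_trans _ (ltn_ord i)).
Qed.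

Lemma cauchy_prod_inv_coef (K : fieldType) (a : nat -> K) n :
  a 0%N != 0 -> cauchy_prod a (inv_coef a) n = (n == 0%N)%:R.
Proof.
move=> a0; rewrite /cauchy_prod big_ord_recl /= subn0 inv_coefE /inv_coef_step.
by rewrite mulVKf // subrK.
Qed.

Context {R : realType}.
Local Notation C := (Cplx R).
Implicit Types (f g : C -> C) (a b : nat -> C).

(** With A = 1 + |1 / a 0| and L = 2 A K^2, induction bounds the i-th term of the
recursion for c n.+1 by 2^-(i+1) L^(n+2), and the powers of 1/2 add up to less
than 1. *)
Lemma geometric_bound_inv_coef a :
  geometric_bound a -> geometric_bound (inv_coef a).
Proof.
move=> [K K1 aK]; pose A := 1 + `|(a 0%N)^-1|; pose L := 2 * A * K ^+ 2.
have K0 : 0 <= K := le_trans ler01 K1.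
have A1 : 1 <= A by rewrite lerDl.
have A0 : 0 <= A := le_trans ler01 A1.
have K2 : 1 <= K ^+ 2 by exact: exprn_ege1.
have AL : A <= L.
  by rewrite /L -mulrA mulrCA ler_peMr // mulr_ege1 // ler1n.
have L1 : 1 <= L := le_trans A1 AL.
have L0 : 0 <= L := le_trans ler01 L1.
have aA : `|(a 0%N)^-1| <= A by rewrite lerDr.
exists L => // n; elim/ltn_ind: n => n IH.
rewrite inv_coefE /inv_coef_step normrM.
case: n IH => [|n] IH.
  by rewrite big_ord0 subr0 normr1 mulr1 expr1 (le_trans aA).
rewrite sub0r normrN.
apply: (@le_trans _ _ (A * \sum_(i < n.+1) K ^+ i.+2 * L ^+ (n - i).+1)).
  apply: ler_pM => //; apply: le_trans (ler_norm_sum _ _ _) _.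
  apply: ler_sum => i _; rewrite normrM; apply: ler_pM => //.
  by rewrite subSS IH // ltnS leq_subr.
rewrite mulr_sumr.
apply: (@le_trans _ _ (\sum_(i < n.+1) 2^-1 ^+ i.+1 * L ^+ n.+2)).
  apply: ler_sum => i _.
  have -> : n.+2 = (i.+1 + (n - i).+1)%N by rewrite addSn addnS subnKC // -ltnS.
  rewrite [in leRHS]exprD [in leLHS]mulrA [in leRHS]mulrA.
  apply: ler_wpM2r; first exact: exprn_ge0.
  have -> : 2^-1 ^+ i.+1 * L ^+ i.+1 = A ^+ i.+1 * K ^+ (2 * i.+1).
    by rewrite exprM -!exprMn; congr (_ ^+ _); rewrite /L; field.
  apply: ler_pM; rewrite ?exprn_ge0 //; first by rewrite ler_eXnr.
  by rewrite ler_weXn2l // mul2n -addnn addSn addnS ltnS ltnS leq_addr.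
rewrite -mulr_suml ler_piMl ?exprn_ge0 //.
suff -> : \sum_(i < n.+1) 2^-1 ^+ i.+1 = 1 - 2^-1 ^+ n.+1 :> C.
  by rewrite gerBl exprn_ge0 // invr_ge0.
elim: n {IH} => [|n IH]; first by rewrite big_ord1 expr1; field.
by rewrite big_ord_recr /= IH [_ ^+ n.+2]exprS; field.
Qed.

(** The product of the partial sums of a and of its reciprocal tends to 1,
because the Cauchy product is the sequence 1, 0, 0, ...; dividing by the
partial sums of a, which tend to f t != 0, gives the limit of the others. *)
Lemma has_psV f a : has_ps f a -> a 0%N != 0 ->
  has_ps (fun t => (f t)^-1) (inv_coef a).
Proof.
move=> fa a0; have f0 := has_ps_neq0 fa a0; case: fa => ga fa.
have gc := geometric_bound_inv_coef ga; split; first exact: gc.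
have [M Mac] := geometric_bound_terms2 ga gc.
apply: filterS2 (filterI fa f0) Mac => t [ha ft0] [hM hN].
have hd := cvg_cauchy_defect hM hN.
have h1 : (fun N => series (fun n => a n * t ^+ n) N *
                    series (fun n => inv_coef a n * t ^+ n) N) @ \oo --> (1 : C).
  have one : series (cauchy_prod (fun n => a n * t ^+ n)
                  (fun n => inv_coef a n * t ^+ n)) @ \oo --> (1 : C).
    rewrite -(@cvg_shiftS C).
    apply: (@eq_cvg_seq _ (fun=> 1)) => [k|]; last exact: cvg_cst.
    rewrite /series /= big_nat_recl //= big1 ?addr0.
      rewrite cauchy_prodX cauchy_prod_inv_coef //= expr0 mulr1 //.
    by move=> i _; rewrite cauchy_prodX cauchy_prod_inv_coef //= mul0r.
  rewrite -[X in _ --> X]add0r.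
  by apply: eq_cvg_seq (cvgD hd one) => k; rewrite fctE subrK.
rewrite -[X in _ --> X]mulr1.
apply: cvg_trans (@cvgM C _ _ _ _ _ _ _ (@cvgV C _ _ _ _ _ ft0 ha) h1).
apply: near_eq_cvg; apply: filterS (@cvgr_neq0 C C _ _ _ _ _ ha ft0) => k k0.
by rewrite /= mulKf.
Qed.

End Inverse.

(** * The complex exponential *)

Section Exponential.
Context {R : realType}.
Local Notation C := (Cplx R).
Implicit Types (f g : C -> C) (a b : nat -> C).

Lemma has_ps_id : has_ps (fun t : C => t) (fun n => (n == 1%N)%:R).
Proof.
split.
  by exists 1 => // n; rewrite expr1n normr_nat; case: eqP.
apply: filterE => t; rewrite -(@cvg_shiftS C) -(@cvg_shiftS C).
apply: (@eq_cvg_seq _ (fun=> t)) => [N|]; last exact: cvg_cst.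
rewrite /series /= !big_nat_recl //= mul0r add0r mul1r expr1 big1 ?addr0 //.
by move=> i _; rewrite mul0r.
Qed.

Lemma cauchy_prod_id (K : pzRingType) (a : nat -> K) n :
  cauchy_prod (fun n => (n == 1%N)%:R) a n.+1 = a n.
Proof.
rewrite /cauchy_prod !big_ord_recl /= mul0r add0r mul1r subSS subn0 big1 ?addr0 //.
by move=> i _; rewrite mul0r.
Qed.

(** Multiplication by c != 0 preserves the punctured neighbourhoods of 0. *)
Lemma near0_scale (P : set C) (c : C) : c != 0 ->
  (\forall t \near (0 : C)^', P t) -> \forall t \near (0 : C)^', P (c * t).
Proof.
move=> c0 /nbhs_ballP [e /= e0 he].
have ec : 0 < e / `|c| by rewrite divr_gt0 // normr_gt0.
have hn : \forall t \near (0 : C)^', t != 0 by exact: nbhs_dnbhs_neq.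
apply: filterS2 (@dnbhs0_lt C C _ ec) hn => t ht t0.
apply: he; last by rewrite /= mulf_neq0.
rewrite -ball_normE /= sub0r normrN normrM mulrC -ltr_pdivlMr ?normr_gt0 //.
Qed.

Lemma has_ps_scale f a (c : C) : c != 0 -> has_ps f a ->
  has_ps (fun t => f (c * t)) (fun n => a n * c ^+ n).
Proof.
move=> c0 [[K K1 aK] fa]; have K0 : 0 <= K := le_trans ler01 K1; split.
  exists (K * (1 + `|c|)).
    by rewrite mulr_ege1 // lerDl.
  move=> n; rewrite normrM normrX exprMn; apply: ler_pM; rewrite ?exprn_ge0 //.
  apply: (@le_trans _ _ ((1 + `|c|) ^+ n)).
    by rewrite lerXn2r ?nnegrE ?addr_ge0 // lerDr.
  by rewrite ler_weXn2l // lerDl.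
move: (near0_scale c0 fa); apply: filterS => t.
by apply: eq_cvg_seq => N; apply: eq_bigr => i _; rewrite exprMn mulrA.
Qed.

Lemma norm_exp_term_le (x : C) n : `|x| <= 4^-1 ->
  `|x ^+ n / n`!%:R| <= 1 * 4^-1 ^+ n.
Proof.
move=> hx; rewrite mul1r normrM normrX normfV normr_nat.
rewrite ler_pdivrMr ?ltr0n ?fact_gt0 //.
apply: (@le_trans _ _ (4^-1 ^+ n)).
  by rewrite lerXn2r ?nnegrE ?invr_ge0.
by rewrite ler_peMr ?exprn_ge0 ?invr_ge0 // ler1n fact_gt0.
Qed.

(** This is the binomial theorem. *)
Lemma cauchy_prod_exp (x y : C) n :
  cauchy_prod (fun n => x ^+ n / n`!%:R) (fun n => y ^+ n / n`!%:R) n =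
  (x + y) ^+ n / n`!%:R.
Proof.
rewrite addrC exprDn /cauchy_prod mulr_suml; apply: eq_bigr => i _.
have nz k : k`!%:R != 0 :> C by rewrite pnatr_eq0 -lt0n fact_gt0.
have /(congr1 (fun k => k%:R : C)) := bin_fact (ltnSE (ltn_ord i)).
rewrite !natrM -mulr_natr => <-.
have := nz i; have := nz (n - i)%N; move: (nz n) => nz1 nz2 nz3.
have nzb : 'C(n, i)%:R != 0 :> C by rewrite pnatr_eq0 -lt0n bin_gt0 -ltnS.
by field; rewrite nz2 nz3 nzb.
Qed.

(** The powers of i are real at even and purely imaginary at odd exponents. *)
Lemma cos_sin_coeff (b : R) n :
  ((cos_coeff b n)%:C + 'i%C * (sin_coeff b n)%:C : C) =
  ('i%C * b%:C) ^+ n / n`!%:R.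
Proof.
have E : ('i%C : C) ^+ n = (if odd n then 'i%C else 1) * (-1) ^+ n./2.
  rewrite -[in LHS](odd_double_half n) exprD -mul2n exprM sqr_i.
  by case: odd; rewrite ?expr1 ?expr0.
have half : odd n -> n.-1./2 = n./2.
  by move=> on; rewrite -[in LHS](odd_double_half n) on /= doubleK.
rewrite exprMn E cos_coeffE sin_coeffE /=.
rewrite !(rmorphM, rmorphXn, fmorphV, rmorph_nat, rmorphN1) /=.
by case: ifP half => [on ->|_ _] //=; ring.
Qed.

(** With t = x + i y, the series of e^x and of cos y + i sin y are known from the
real case, and the series of e^t is their Cauchy product. *)
Lemma has_ps_cexp : has_ps (@cexp R) (fun n => (n`!%:R)^-1).
Proof.
split.
  exists 1 => // n; rewrite expr1n normfV normr_nat invf_le1 ?ltr0n ?fact_gt0 //.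
  by rewrite ler1n fact_gt0.
have q0 : 0 < 4^-1 :> C by rewrite invr_gt0.
apply: filterS (@dnbhs0_le C C _ q0) => t ht.
pose x := complex.Re t; pose y := complex.Im t.
have hx : `|x%:C : C| <= 4^-1.
  apply: le_trans ht; apply: le_trans (normc_ge_Re t).
  by rewrite normc_def /= expr0n addr0 sqrtr_sqr.
have hy : `|'i%C * y%:C : C| <= 4^-1.
  apply: le_trans ht; rewrite !normc_def /= !(mul0r, mul1r, mulr0) subr0 add0r.
  by rewrite lecR ler_sqrt ?addr_ge0 ?sqr_ge0 // expr0n add0r lerDr sqr_ge0.
have hd := cvg_cauchy_defect (fun n => norm_exp_term_le n hx) (fun n => norm_exp_term_le n hy).
have cu : series (fun n => (x%:C : C) ^+ n / n`!%:R) @ \oo --> ((expR x)%:C : C).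
  have : series (exp_coeff x) @ \oo --> expR x.
    exact: is_cvg_series_exp_coeff.
  move=> /cvg_to_complex; apply: eq_cvg_seq => N.
  rewrite /series /= rmorph_sum; apply: eq_bigr => i _.
  by rewrite /exp_coeff /= rmorphM rmorphXn fmorphV rmorph_nat.
have cv : series (fun n => ('i%C * y%:C : C) ^+ n / n`!%:R) @ \oo -->
    ((cos y)%:C + 'i%C * (sin y)%:C : C).
  have h1 : series (cos_coeff y) @ \oo --> cos y.
    by rewrite cos.unlock; exact: is_cvg_series_cos_coeff.
  have h2 : series (sin_coeff y) @ \oo --> sin y.
    by rewrite sin.unlock; exact: is_cvg_series_sin_coeff.
  have i2 : (fun=> 'i%C : C) @ \oo --> ('i%C : C) by exact: cvg_cst.
  have h3 : (fun N => ((series (cos_coeff y) N)%:C : C) +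
      ('i%C : C) * ((series (sin_coeff y) N)%:C : C)) @ \oo -->
      (((cos y)%:C : C) + ('i%C : C) * ((sin y)%:C : C)).
    exact: cvgD (cvg_to_complex h1) (@cvgM C _ _ _ _ _ _ _ i2 (cvg_to_complex h2)).
  apply: eq_cvg_seq h3 => N; rewrite /series /= !rmorph_sum mulr_sumr -big_split /=.
  by apply: eq_bigr => i _; rewrite -cos_sin_coeff.
have -> : cexp t = (expR x)%:C * ((cos y)%:C + 'i%C * (sin y)%:C).
  by rewrite /cexp; congr (_ * _); exact: (complexE (cos y +i* sin y)).
rewrite -[X in _ --> X]subr0.
apply: eq_cvg_seq (cvgB (@cvgM C _ _ _ _ _ _ _ cu cv) hd) => N.
rewrite !fctE opprB addrC subrK; apply: eq_bigr => i _.
rewrite cauchy_prod_exp mulrC; congr (_ * _ ^+ _).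
by rewrite [RHS]complexE.
Qed.

End Exponential.

(** * Taylor expansion of the Apostol-Bernoulli generating function *)

Section ApostolBernoulli.
Context {R : realType}.
Local Notation C := (Cplx R).
Implicit Types (f g : C -> C) (a b : nat -> C).

(** This is has_ps0 applied to the difference. *)
Lemma has_ps_uniq f a b : has_ps f a -> has_ps f b -> a =1 b.
Proof.
move=> fa fb n; apply/eqP; rewrite -subr_eq0; apply/eqP.
apply: (@has_ps0 R (fun n => a n - b n)).
apply: has_ps_eq (has_psD fa (has_psZ (-1) fb)) => [t|k].
  by rewrite mulN1r subrr.
by rewrite mulN1r.
Qed.

Lemma cexp0 : cexp (0 : C) = 1.
Proof.
by rewrite /cexp /= expR0 cos0 sin0 mul1r.
Qed.

Lemma cexpD (x y : C) : cexp (x + y) = cexp x * cexp y.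
Proof.
case: x y => [x1 x2] [y1 y2]; rewrite /cexp /= expRD cosD sinD.
apply/eqP; rewrite eq_complex /=; apply/andP; split; apply/eqP; ring.
Qed.

Lemma cexp_neq0 (x : C) : cexp x != 0.
Proof.
apply/eqP => x0; have := cexpD x (- x).
by rewrite subrr cexp0 x0 mul0r => /eqP; rewrite oner_eq0.
Qed.

Lemma cexpN (x : C) : cexp (- x) = (cexp x)^-1.
Proof.
by apply: (mulfI (cexp_neq0 x)); rewrite -cexpD subrr cexp0 divff ?cexp_neq0.
Qed.

Lemma cexpMn (x : C) n : cexp (n%:R * x) = cexp x ^+ n.
Proof.
elim: n => [|n IH]; first by rewrite mul0r cexp0.
by rewrite -natr1 mulrDl mul1r cexpD IH exprSr.
Qed.

Lemma has_ps_cexpZ (c : C) :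
  has_ps (fun t => cexp (c * t)) (fun n => c ^+ n / n`!%:R).
Proof.
have [->|c0] := eqVneq c 0.
  apply: has_ps_eq (has_ps_cst 1) => [t|[|n]].
  - by rewrite mul0r cexp0.
  - by rewrite expr0 divr1.
  - by rewrite expr0n mul0r.
by apply: has_ps_eq (has_ps_scale c0 has_ps_cexp) => // n; rewrite mulrC.
Qed.

(** Only the geometric bound is at stake: at one point t != 0 of convergence the
terms are bounded, so the coefficients grow at most like |t|^-n. *)
Lemma taylor_at0_has_ps f b :
  taylor_at0 f b -> has_ps f (fun j => b j / j`!%:R).
Proof.
move=> fb.
have fb' : \forall t \near (0 : C)^',
    series (fun j => b j / j`!%:R * t ^+ j) @ \oo --> f t.
  apply: filterS fb => t; apply: eq_cvg_seq => N.
  by apply: eq_bigr => i _; rewrite mulrA mulrAC.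
split; last exact: fb'.
have hn : \forall t \near (0 : C)^', t != 0 by exact: nbhs_dnbhs_neq.
have [t [ht t0]] :=
  @filter_ex _ _ (Proper_dnbhs_numFieldType (0 : C)) _ (filterI fb' hn).
have cv0 : (fun j => b j / j`!%:R * t ^+ j) @ \oo --> (0 : C).
  by apply: (@cvg_series_cvg_0 C C); apply/cvg_ex; exists (f t).
have [M M0 hM] : exists2 M : C, 0 <= M & forall n, `|b n / n`!%:R * t ^+ n| <= M.
  have : bounded_fun (fun j => b j / j`!%:R * t ^+ j).
    by apply: (@cvg_seq_bounded C C); apply/cvg_ex; exists 0.
  move=> [M [Mr hM]]; exists (`|M| + 1); first by rewrite addr_ge0.
  move=> n; apply: (hM (`|M| + 1)) => //.
  by rewrite (le_lt_trans (real_ler_norm Mr)) // ltrDl.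
exists (1 + M + `|t|^-1).
  by rewrite -addrA lerDl addr_ge0 // invr_ge0.
move=> n.
have -> : `|b n / n`!%:R| = `|b n / n`!%:R * t ^+ n| * `|t|^-1 ^+ n.
  by rewrite [in RHS]normrM [`|t ^+ n|]normrX exprVn mulfK // expf_neq0 // normr_eq0.
rewrite exprS; apply: ler_pM; rewrite ?exprn_ge0 ?invr_ge0 //.
  apply: le_trans (hM n) _; rewrite -addrA addrCA lerDl addr_ge0 // invr_ge0 //.
by rewrite lerXn2r ?nnegrE ?addr_ge0 ?invr_ge0 // lerDr addr_ge0.
Qed.

Lemma has_ps_taylor_at0 f a :
  has_ps f a -> taylor_at0 f (fun j => a j * j`!%:R).
Proof.
move=> [_ fa]; apply: filterS fa => t; apply: eq_cvg_seq => N.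
apply: eq_bigr => i _.
by rewrite -mulrA [_`!%:R * _]mulrC divfK // pnatr_eq0 -lt0n fact_gt0.
Qed.

Lemma has_ps_denominator (mu : C) :
  has_ps (fun t => mu * cexp t - 1) (fun n => mu / n`!%:R - (n == 0%N)%:R).
Proof.
apply: has_ps_eq (has_psD (has_psZ mu has_ps_cexp) (has_ps_cst (-1))) => // n.
by rewrite mulNrn.
Qed.

(** For mu = 1 the denominator has a simple zero at 0; dividing it by t leaves
constant term 1. *)
Lemma has_ps_denominator1 :
  has_ps (fun t : C => (1 * cexp t - 1) / t) (fun n => (n.+1`!%:R)^-1).
Proof.
have := has_ps_shift (has_ps_denominator 1).
by apply: has_ps_eq => [t|n] /=; rewrite ?divr1 ?subrr subr0 // mul1r.
Qed.

Lemma denominator_neq0 (mu : C) :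
  \forall t \near (0 : C)^', mu * cexp t - 1 != 0.
Proof.
have [->|mu1] := eqVneq mu 1; last first.
  by apply: has_ps_neq0 (has_ps_denominator mu) _; rewrite divr1 subr_eq0.
have n0 : (1`!%:R)^-1 != 0 :> C by rewrite invr1 oner_eq0.
apply: filterS (has_ps_neq0 has_ps_denominator1 n0) => t.
by apply: contra_neq => ->; rewrite mul0r.
Qed.

(** When mu = 1 the factor t of the numerator is used to cancel the zero of the
denominator; otherwise the denominator is already invertible. *)
Lemma apostol_bernoulli_gen_has_ps (x mu : C) :
  exists a, has_ps (apostol_bernoulli_gen x mu) a.
Proof.
have [->|mu1] := eqVneq mu 1; last first.
  have d0 : mu / 0`!%:R - (0%N == 0%N)%:R != 0 :> C by rewrite divr1 subr_eq0.
  eexists; apply: has_psM (has_psM has_ps_id (has_ps_cexpZ x)) _.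
  exact: has_psV (has_ps_denominator mu) d0.
have n0 : (1`!%:R)^-1 != 0 :> C by rewrite invr1 oner_eq0.
have fa := has_psM (has_ps_cexpZ x) (has_psV has_ps_denominator1 n0).
eexists; apply: has_ps_eq fa => // t.
by rewrite /apostol_bernoulli_gen invfM invrK mulrA mulrC mulrA.
Qed.

(** Existence of an expansion is what makes the choice in the definition of the
coefficients meaningful. *)
Lemma apostol_bernoulli_has_ps (x mu : C) :
  has_ps (apostol_bernoulli_gen x mu)
         (fun j => apostol_bernoulli j x mu / j`!%:R).
Proof.
apply: taylor_at0_has_ps; rewrite /apostol_bernoulli.
have [a /has_ps_taylor_at0 ha] := apostol_bernoulli_gen_has_ps x mu.
have := @getPex _ [set b | taylor_at0 (apostol_bernoulli_gen x mu) b].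
by apply; exists (fun j => a j * j`!%:R).
Qed.

End ApostolBernoulli.

(** * Character sums and their generating function *)

Section CharacterSums.

(** Substituting k = (n + 1) q - r in the last of the n + 1 blocks of length q
turns it into w^(-(n+1)q) times a sum independent of n, and the progression
of these powers is summed by induction. *)
Lemma sum_periodic (K : fieldType) (c : int -> K) (q n : nat) (w : K) :
  (forall a b : int, (a = b %[mod q%:Z])%Z -> c a = c b) ->
  w != 0 -> w ^+ q != 1 ->
  \sum_(1 <= k < (n * q).+1) c k%:Z * w ^- k =
  (1 - w ^- (n * q)) / (w ^+ q - 1) * \sum_(r < q) c (- r%:Z) * w ^+ r.
Proof.
move=> cper w0 wq; set S := \sum_(r < q) _.
have wq1 : w ^+ q - 1 != 0 by rewrite subr_eq0.
elim: n => [|n IH]; first by rewrite mul0n big_geq // expr0 invr1 subrr !mul0r.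
rewrite (@big_cat_nat _ _ _ (n * q).+1) //=; last by rewrite ltnS leq_mul2r leqnSn orbT.
rewrite IH.
have -> : \sum_((n * q).+1 <= k < (n.+1 * q).+1) c k%:Z * w ^- k =
    w ^- (n.+1 * q) * S.
  rewrite -{1}[(n * q).+1]add0n big_addn subSS mulSn addnK big_mkord.
  rewrite (reindex_inj rev_ord_inj) mulr_sumr; apply: eq_bigr => i _ /=.
  (* The index i counts backwards from the end of the block. *)
  have Ek : (q - i.+1 + (n * q).+1 + i = n.+1 * q)%N.
    by rewrite addnS -addSn -subSn // subSS addnAC subnK ?mulSn // ltnW.
  rewrite mulrCA; congr (_ * _).
    apply: cper; have -> : (q - i.+1 + (n * q).+1)%N%:Z = n.+1%:Z * q%:Z + - i%:Z.
      by rewrite -PoszM -Ek [in RHS]PoszD addrK.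
    by rewrite modzMDl.
  by rewrite -mulSn -Ek [in RHS]exprD invfM mulfVK // expf_neq0.
have wn : w ^- (n * q) = w ^+ q * w ^- (n.+1 * q).
  by rewrite mulSn exprD invfM mulrA divff ?mul1r // expf_neq0.
by rewrite wn; move: (w ^- (n.+1 * q)) (w ^+ q) wq1 => Y X X1; field.
Qed.

Context {R : realType}.
Local Notation C := (Cplx R).

(** The summand r = q of the definition has integer part 1 and fractional part 0;
by periodicity it is the summand r = 0. *)
Lemma apostol_bernoulli_chi0 (q : nat) (hq : (0 < q)%N) (chi : int -> C)
    (hchi : forall a b : int, (a = b %[mod q%:Z])%Z -> chi a = chi b)
    (lambda : C) (k : nat) :
  apostol_bernoulli_chi q chi k 0 lambda =
  q%:R ^+ k / q%:R * \sum_(r < q) chi (- r%:Z) * lambda ^+ r *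
    apostol_bernoulli k (r%:R / q%:R : C) (lambda ^+ q).
Proof.
have q0 : q%:R != 0 :> C by rewrite pnatr_eq0 -lt0n.
have q0R : q%:R != 0 :> R by rewrite pnatr_eq0 -lt0n.
rewrite /apostol_bernoulli_chi; congr (_ * _).
  by rewrite expfzDr // exprN1.
rewrite big_nat_recr //= add0r divff // floor1 mulr1 subrr expr0z mulr1.
rewrite /frac_part floor1 subrr.
case: q hq hchi q0 q0R => [//|q] hq hchi q0 q0R.
rewrite big_ord_recl /= expr0 mulr1 mul0r addrC; congr (_ + _).
  by congr (_ * _); apply: hchi; rewrite -[- _]addr0 -mulN1r modzMDl oppr0.
rewrite big_add1 big_mkord; apply: eq_bigr => i _; rewrite /bump /= !add1n add0r.
have -> : Num.floor (i.+1%:R / q.+1%:R : R) = 0.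
  apply/eqP; rewrite floor_eq.
  rewrite divr_ge0 ?ler0n //= add0r ltr_pdivrMr ?ltr0n // mul1r ltr_nat.
  by rewrite ltnS ltn_ord.
rewrite mulr0 subr0 subr0 rmorphM fmorphV !rmorph_nat //.
Qed.

(** The factor q^(k-1) is the effect of the substitution t -> q t on a generating
function, divided by q because of the factor t in its numerator. *)
Lemma character_bernoulli_has_ps (q : nat) (hq : (0 < q)%N) (chi : int -> C)
    (hchi : forall a b : int, (a = b %[mod q%:Z])%Z -> chi a = chi b)
    (lambda : C) :
  has_ps (fun t => \sum_(r < q) chi (- r%:Z) * lambda ^+ r *
                   (t * cexp (r%:R * t) / (lambda ^+ q * cexp (q%:R * t) - 1)))
         (fun k => apostol_bernoulli_chi q chi k 0 lambda / k`!%:R).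
Proof.
have q0 : q%:R != 0 :> C by rewrite pnatr_eq0 -lt0n.
have fr (r : 'I_q) := has_psZ (q%:R^-1 * (chi (- r%:Z) * lambda ^+ r))
   (has_ps_scale q0 (apostol_bernoulli_has_ps (r%:R / q%:R) (lambda ^+ q))).
apply: has_ps_eq (has_ps_sum (index_enum _) fr) => [t|k].
  apply: eq_bigr => r _; rewrite /apostol_bernoulli_gen.
  rewrite (mulrA (r%:R / q%:R)) divfK //.
  by move: (_ - 1)^-1 (cexp (r%:R * t)) => D E; field.
rewrite apostol_bernoulli_chi0 // mulr_sumr mulr_suml.
by apply: eq_bigr => r _; ring.
Qed.

End CharacterSums.

(** * Comparison of coefficients *)

(** This is sum_periodic with w = lambda e^(-t).  The inner argument -t is
written -1 * t so as to fit the rescaling of power series. *)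
Lemma exp_sum_character (R : realType) (n q : nat) (hq : (0 < q)%N)
    (chi : int -> Cplx R)
    (hchi : forall a b : int, (a = b %[mod q%:Z])%Z -> chi a = chi b)
    (lambda : Cplx R) (hlambda : lambda != 0) :
  \forall t \near (0 : Cplx R)^',
    (\sum_(r < q) chi (- r%:Z) * lambda ^+ r *
       (-1 * t * cexp (r%:R * (-1 * t)) /
         (lambda ^+ q * cexp (q%:R * (-1 * t)) - 1))) *
      (lambda ^- (n * q) * cexp ((n * q)%:R * t) - 1) =
    t * \sum_(1 <= k < (n * q).+1) chi k%:Z * lambda ^- k * cexp (k%:R * t).
Proof.
have q0 : q%:R * -1 != 0 :> Cplx R.
  by rewrite mulrN1 oppr_eq0 pnatr_eq0 -lt0n.
apply: filterS (near0_scale q0 (denominator_neq0 (lambda ^+ q))) => t.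
rewrite -mulrA cexpMn mulN1r => hD.
pose w := lambda * cexp (- t).
have w0 : w != 0 by rewrite mulf_neq0 ?cexp_neq0.
have wV k : w ^- k = lambda ^- k * cexp (k%:R * t).
  by rewrite cexpMn exprMn invfM cexpN exprVn invrK.
rewrite -wV.
under eq_bigr do rewrite cexpMn.
under [in RHS]eq_bigr do rewrite -mulrA -wV.
rewrite -exprMn -/w in hD *.
rewrite (sum_periodic n hchi w0); last by rewrite -subr_eq0.
have -> : \sum_(r < q) chi (- r%:Z) * lambda ^+ r *
     (- t * cexp (- t) ^+ r / (w ^+ q - 1)) =
   - t / (w ^+ q - 1) * \sum_(r < q) chi (- r%:Z) * w ^+ r.
  rewrite mulr_sumr; apply: eq_bigr => r _; rewrite [w ^+ r]exprMn.
  by move: (_ - 1)^-1 => D; ring.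
by move: (_ - 1)^-1 => D; ring.
Qed.

Theorem theorem2p5 (R : realType) (n q m : nat) (hn : (0 < n)%N)
    (hq : (0 < q)%N) (chi : int -> Cplx R)
    (hchi : dirichlet_character q chi) (lambda : Cplx R)
    (hlambda : lambda != 0) :
  \sum_(1 <= k < (n * q).+1) chi k%:Z * lambda ^- k * k%:R ^+ m =
    lambda ^- (q * n) / m.+1%:R *
      (\sum_(0 <= k < m.+1)
         'C(m.+1, k)%:R * (-1) ^+ k *
         apostol_bernoulli_chi q chi k 0 lambda *
         (n * q)%:R ^+ (m.+1 - k)) +
    (-1) ^+ m.+1 * apostol_bernoulli_chi q chi m.+1 0 lambda *
      (lambda ^- (n * q) - 1) / m.+1%:R.
Proof.
have [chi_per _ _] := hchi.
have N1 : -1 != 0 :> Cplx R by rewrite oppr_eq0 oner_eq0.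
have psB := has_ps_scale N1 (character_bernoulli_has_ps hq chi_per lambda).
have psE := has_psD (has_psZ (lambda ^- (n * q)) (has_ps_cexpZ (n * q)%:R))
                    (has_ps_cst (-1 : Cplx R)).
have psL := has_psM (@has_ps_id R) (has_ps_sum (index_iota 1 (n * q).+1)
  (fun k => has_psZ (chi k%:Z * lambda ^- k) (has_ps_cexpZ k%:R))).
have psR := has_ps_ext (exp_sum_character n hq chi_per hlambda) (has_psM psB psE).
(* Coefficients of t^(m+1); the left-hand one is that of t^m in the sum. *)
have := has_ps_uniq psL psR m.+1; rewrite cauchy_prod_id.
have nz k : k`!%:R != 0 :> Cplx R by rewrite pnatr_eq0 -lt0n fact_gt0.
have m0 : m.+1%:R != 0 :> Cplx R by rewrite pnatr_eq0.
move=> /(congr1 (fun z => z * m`!%:R)).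
rewrite mulr_suml.
under eq_bigr do rewrite -!mulrA mulVf // mulr1 mulrA.
move=> ->; rewrite /cauchy_prod big_ord_recr /= mulrDl; congr (_ + _).
  rewrite big_mkord mulr_suml mulr_sumr; apply: eq_bigr => i _.
  have im : (i <= m.+1)%N := ltnW (ltn_ord i).
  rewrite subn_eq0 leqNgt ltn_ord mulr0n addr0 [(q * n)%N]mulnC.
  have /(congr1 (fun k => k%:R : Cplx R)) := bin_fact im.
  rewrite factS !natrM => E.
  have -> : m`!%:R = 'C(m.+1, i)%:R * (i`!%:R * (m.+1 - i)`!%:R) / m.+1%:R :> Cplx R.
    by rewrite E mulrC mulKf.
  have := nz i; have := nz (m.+1 - i)%N => nz1 nz2.
  by move: m.+1%:R m0 => M m0; field; rewrite m0 expf_neq0 ?nz1.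
(* The term k = m + 1, where both summands of the second factor contribute. *)
rewrite subnn eqxx fact0 expr0 divr1 mulr1 mulr1n.
rewrite factS natrM.
have := nz m => nz1.
by move: m.+1%:R m0 => M m0; field; rewrite m0 expf_neq0 ?nz1.
Qed.
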